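(* Let $u$ and $v$ be functions with the regularity specified in the context such that, in $\Omega\times(0,+\infty)$, $$\partial_t u(x,t)\le c\Delta u(x,t)+\int_{\Omega}\big(u(y,t)-\Theta\big)_+\,K(x,y)\,dy$$ and $$\partial_t v(x,t)\ge c\Delta v(x,t)+\int_{\Omega}\big(v(y,t)-\Theta\big)_+\,K(x,y)\,dy,$$ with $u(x,0)\le v(x,0)$ for all $x\in\Omega$ and $u(x,t)\le v(x,t)$ for all $x\in\partial\Omega$ and $t\in[0,+\infty)$. Then $u(x,t)\le v(x,t)$ for all $x\in\Omega$ and $t\in[0,+\infty)$.
   Context: $\Omega\subset\mathbb{R}^n$ is a bounded and smooth domain, $c\in(0,+\infty)$, $\Theta\in\mathbb{R}$, and $r_+:=\max\{r,0\}$ for $r\in\mathbb{R}$. The Laplacian $\Delta$ acts in the space variable $x$. The kernel $K:\Omega\times\Omega\to[0,+\infty)$ is measurable, nonnegative and integrable, with $\sup_{x\in\Omega}\int_\Omega K(x,y)\,dy<+\infty$. Regularity (for $w=u$ and $w=v$): $w:\overline\Omega\times[0,+\infty)\to\mathbb{R}$ is continuous, for every $x\in\Omega$ the map $(0,+\infty)\ni t\mapsto w(x,t)$ is continuously differentiable, and for every $t\in(0,+\infty)$ the map $\Omega\ni x\mapsto w(x,t)$ is twice continuously differentiable. *)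

(* Defs.v *)
From HB Require Import structures.
From mathcomp Require Import all_boot all_order all_algebra.
From mathcomp Require Import all_classical all_reals all_analysis.

Set Implicit Arguments.
Unset Strict Implicit.
Unset Printing Implicit Defensive.

Import Order.TTheory GRing.Theory Num.Theory.
Import numFieldTopology.Exports numFieldNormedType.Exports.

Local Open Scope classical_set_scope.
Local Open Scope ring_scope.

(* MathComp-Analysis has Lebesgue measure only on the line. On R^n, n >= 1, we
   take the textbook one: the outer measure
     A |-> inf { \sum_k vol(Q_k) | A is covered by the boxes Q_k }
   restricted to its Caratheodory-measurable sets. It is complete, so that
   "measurable" means Lebesgue measurable, not merely Borel. *)
Section lebesgue_outer.
Context {R : realType} {n : nat}.
Implicit Types (q : 'rV[R]_n.+1 * 'rV[R]_n.+1) (A : set 'rV[R]_n.+1).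

Definition box q : set 'rV[R]_n.+1 :=
  [set x | forall i, q.1 ord0 i < x ord0 i <= q.2 ord0 i].

Definition box_volume q : R :=
  \prod_(i < n.+1) Num.max 0 (q.2 ord0 i - q.1 ord0 i).

Definition lebesgue_outer A : \bar R :=
  ereal_inf [set (\sum_(0 <= k <oo) (box_volume (q k))%:E)%E
            | q in [set q : nat -> 'rV[R]_n.+1 * 'rV[R]_n.+1
                   | A `<=` \bigcup_k box (q k)]].

Lemma box_volume_ge0 q : 0 <= box_volume q.
Proof. by apply: prodr_ge0 => i _; rewrite le_max lexx. Qed.

Local Open Scope ereal_scope.

Lemma lebesgue_outer_ge0 A : 0 <= lebesgue_outer A.
Proof.
apply: le_ereal_inf_tmp => x [q _ <-{x}].
by apply: nneseries_ge0 => k _ _; rewrite lee_fin box_volume_ge0.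
Qed.

Lemma le_lebesgue_outer : {homo lebesgue_outer : A B / A `<=` B >-> A <= B}.
Proof.
move=> A B AB; apply/ereal_inf_le_tmp => x [q Bq <-{x}].
by exists q => //; exact: subset_trans AB Bq.
Qed.

Lemma lebesgue_outer0 : lebesgue_outer set0 = 0.
Proof.
apply/eqP; rewrite eq_le lebesgue_outer_ge0 andbT.
apply: ereal_inf_lbound; exists (fun=> (0%R, 0%R)); first exact: sub0set.
apply: eseries0 => k _ _; congr EFin.
by rewrite /box_volume big_ord_recl /= subrr maxxx mul0r.
Qed.

Lemma lebesgue_outer_sigma_subadditive : sigma_subadditive lebesgue_outer.
Proof.
move=> A; have [[i ioo]|] := pselect (exists i, lebesgue_outer (A i) = +oo).
  rewrite (eseries_pinfty _ _ ioo) ?leey// => k _.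
  by rewrite -ltNye (lt_le_trans _ (lebesgue_outer_ge0 _)).
rewrite -forallNE => Aoo.
suff add2e (e : {posnum R}) : lebesgue_outer (\bigcup_k A k) <=
    \sum_(i <oo) lebesgue_outer (A i) + e%:num%:E.
  by apply/lee_addgt0Pr => _/posnumP[].
rewrite (le_trans _ (epsilon_trick _ _ _))//; last first.
  by move=> k; exact: lebesgue_outer_ge0.
pose vol q := (box_volume q)%:E.
have vol0 q : 0 <= vol q by rewrite lee_fin box_volume_ge0.
pose P k (q : nat -> 'rV[R]_n.+1 * 'rV[R]_n.+1) :=
  A k `<=` \bigcup_j box (q j) /\
  \sum_(j <oo) vol (q j) <= lebesgue_outer (A k) + (e%:num / (2 ^ k.+1)%:R)%:E.
have [G PG] : {G : nat -> nat -> _ & forall k, P k (G k)}.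
  apply: (@choice _ _ P) => k; rewrite /P.
  have fA : lebesgue_outer (A k) \is a fin_num.
    by rewrite ge0_fin_numE ?lebesgue_outer_ge0// ltey; apply/eqP/Aoo.
  have en1 : (0 < e%:num / (2 ^ k.+1)%:R)%R by [].
  have [x [q Aq <-] xS] := lb_ereal_inf_adherent en1 fA.
  by exists q; split => //; exact/ltW.
apply: (@le_trans _ _ (\esum_(i in setT) (vol \o uncurry G) i)).
  apply: ereal_inf_lbound => /=.
  have /card_esym/ppcard_eqP[f] := card_nat2.
  exists (uncurry G \o f).
    move=> t [i _] /(PG i).1[j _ Gijt].
    by exists (f^-1%FUN (i, j)) => //=; rewrite invK ?inE.
  rewrite -(esum_pred_image (vol \o uncurry G) _ xpredT) ?[fun=> _]set_true//.
    by rewrite image_eq.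
  by move=> a _; exact: vol0.
have -> : \esum_(i in setT) (vol \o uncurry G) i =
    \sum_(i <oo) \sum_(j <oo) vol (G i j).
  pose J : nat -> set (nat * nat) := fun i => [set (i, j) | j in setT].
  rewrite (_ : setT = \bigcup_k J k); last first.
    by rewrite predeqE => -[a b]; split => // _; exists a => //; exists b.
  rewrite esum_bigcupT /=; last 2 first.
  - apply/trivIsetP => i j _ _ ij.
    rewrite predeqE => -[a m] /=; split => //= -[] [_] _ [<-{a} _].
    by move=> [m' _] [] /esym/eqP; rewrite (negbTE ij).
  - by move=> a; exact: vol0.
  rewrite -(image_id [set: nat]) -fun_true esum_pred_image//; last first.
    by move=> a _; apply: esum_ge0 => b _; exact: vol0.
  apply: eq_eseriesr => /= j _.
  rewrite -(esum_pred_image (vol \o uncurry G) (pair j) predT)//=; last first.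
    by move=> ? ? _ _; exact: (@can_inj _ _ _ snd).
  by congr esum; rewrite predeqE => -[a b]; split; move=> [i _ <-]; exists i.
apply: lee_nneseries => k *; last exact: (PG k).2.
by apply: nneseries_ge0 => *; exact: vol0.
Qed.

HB.instance Definition _ := isOuterMeasure.Build R 'rV[R]_n.+1 lebesgue_outer
  lebesgue_outer0 lebesgue_outer_ge0 le_lebesgue_outer
  lebesgue_outer_sigma_subadditive.

End lebesgue_outer.

(* R^n.+1 equipped with the Lebesgue measurable sets; as a type it is
   convertible to 'rV[R]_n.+1. *)
Definition lebesgue_space (R : realType) (n : nat) :=
  caratheodory_type (@lebesgue_outer R n).

Definition lebesgue_rV (R : realType) (n : nat) :
    set (lebesgue_space R n) -> \bar R :=
  @lebesgue_outer R n.
Arguments lebesgue_rV : clear implicits.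

HB.instance Definition _ (R : realType) (n : nat) :=
  Measurable.on (lebesgue_space R n).
HB.instance Definition _ (R : realType) (n : nat) := isMeasure.Build _ _ _
  (lebesgue_rV R n)
  (@caratheodory_measure0 _ _ (@lebesgue_outer R n))
  (@caratheodory_measure_ge0 _ _ (@lebesgue_outer R n))
  (@caratheodory_measure_sigma_additive _ _ (@lebesgue_outer R n)).

Section calculus.
Context {R : realType} {n : nat}.
Implicit Types (f : 'rV[R]_n.+1 -> R) (U : set 'rV[R]_n.+1).

Definition partial (i : 'I_n.+1) f : 'rV[R]_n.+1 -> R :=
  fun x => 'D_(delta_mx ord0 i) f x.

Definition laplacian f : 'rV[R]_n.+1 -> R :=
  fun x => \sum_(i < n.+1) partial i (partial i f) x.

(* Meant for open sets U. *)
Fixpoint Ck_on (k : nat) U f : Prop :=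
  (forall x, U x -> {for x, continuous f}) /\
  if k is k'.+1 then
    forall i, (forall x, U x -> derivable f x (delta_mx ord0 i)) /\
              Ck_on k' U (partial i f)
  else True.

Definition smooth_on U f : Prop := forall k, Ck_on k U f.

Definition bdry U : set 'rV[R]_n.+1 := closure U `\` U°.

(* The boundary is smooth: near each of its points, U is the strict sublevel
   set of a smooth function whose gradient does not vanish at the point. *)
Definition smooth_boundary U : Prop :=
  forall p, bdry U p ->
    exists (V : set 'rV[R]_n.+1) (phi : 'rV[R]_n.+1 -> R),
      [/\ open_nbhs p V, smooth_on V phi, exists i, partial i phi p != 0
        & U `&` V = [set x | phi x < 0] `&` V].

Definition bounded_smooth_domain U : Prop :=
  [/\ open U, connected U, U !=set0, bounded_set U & smooth_boundary U].

End calculus.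

Section problem.
Context {R : realType} {n : nat}.
Local Notation E := 'rV[R]_n.+1.
Implicit Types (Omega : set E) (K : E -> E -> R) (w : E -> R -> R).

(* Functions on R^n.+1 x R^n.+1 are integrated over 'rV[R]_(n.+1 + n.+1), a
   vector of which is the pair of its left and right halves. *)
Definition pair_set Omega : set (lebesgue_space R (n + n.+1)) :=
  [set z : 'rV[R]_(n.+1 + n.+1) | Omega (lsubmx z) /\ Omega (rsubmx z)].

Definition pair_fun K : lebesgue_space R (n + n.+1) -> R :=
  fun z : 'rV[R]_(n.+1 + n.+1) => K (lsubmx z) (rsubmx z).

(* Joint Lebesgue measurability gives measurability of the sections K x only
   for almost every x; the supremum over all x presupposes it for every x. *)
Definition admissible_kernel Omega K : Prop :=
  [/\ forall x y, Omega x -> Omega y -> 0 <= K x y,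
      measurable_fun (pair_set Omega) (pair_fun K),
      (lebesgue_rV R (n + n.+1)).-integrable (pair_set Omega)
        (EFin \o pair_fun K),
      forall x, Omega x ->
        measurable_fun (Omega : set (lebesgue_space R n)) (K x)
    & (ereal_sup [set \int[lebesgue_rV R n]_(y in Omega) (K x y)%:E
                 | x in Omega] < +oo)%E].

Definition regular Omega w : Prop :=
  [/\ {within closure Omega `*` [set t | 0 <= t], continuous (uncurry w)},
      forall x, Omega x -> forall t, 0 < t ->
        derivable (w x) t 1 /\ {for t, continuous (derive1 (w x))}
    & forall t, 0 < t -> Ck_on 2 Omega (w ^~ t)].

Definition source Omega K (Theta : R) w : E -> R -> \bar R :=
  fun x t => (\int[lebesgue_rV R n]_(y in Omega)
                (Num.max (w y t - Theta) 0 * K x y)%:E)%E.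

End problem.

(* Main.v *)
Require Import Defs.
From HB Require Import structures.
From mathcomp Require Import all_boot all_order all_algebra.
From mathcomp Require Import all_classical all_reals all_analysis.
From mathcomp Require Import measurable_realfun ring lra.

Set Implicit Arguments.
Unset Strict Implicit.
Unset Printing Implicit Defensive.

Import Order.TTheory GRing.Theory Num.Theory.
Import numFieldTopology.Exports numFieldNormedType.Exports.

Local Open Scope classical_set_scope.
Local Open Scope ring_scope.

(** Suppose that [w = u - v] is positive somewhere up to a time [T]. The proof
    looks at a maximum point [(x0, t0)] of [exp (- l t) * w x t] over the compact
    set [closure Omega * [0, T]]. There [w] is positive, so the initial and
    boundary inequalities force [x0] into [Omega] and [t0] to be positive.
    Comparing the two differential inequalities at that point:
    - in space, [w (., t0)] is maximal at [x0], so the Laplacian of [w] is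
      nonpositive there ([laplacian_le0_max]);
    - in time, [exp (- l t) * w x0 t] does not exceed, before [t0], its value at
      [t0], which gives [l * w <= dw/dt] ([derive1_ge_exp_left_max]); only times
      before [t0] are compared, so [t0 = T] needs no separate treatment;
    - for the nonlocal term, [u <= v + w x0 t0] on [Omega] at time [t0] and
      [r |-> max (r - Theta) 0] is nondecreasing and 1-Lipschitz, so the source
      of [u] exceeds that of [v] by at most [S * w x0 t0], with [S] the supremum
      over [x] of the integral of [K x] ([ge0_integral_pos_part_le]).
    Together, [l * w <= dw/dt <= S * w] at [(x0, t0)], which is absurd for
    [l = S + 1] because [w x0 t0 > 0].

    The sources are integrals over [Omega] for the measure obtained from the
    outer measure by boxes. Splitting and comparing them requires that [Omega]
    and continuous functions on it be Caratheodory measurable. This is derived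
    from the half-spaces: a half-space cuts each box into two boxes whose volumes
    add up, hence it satisfies the Caratheodory criterion; a ball of the sup norm
    is a finite intersection of slabs, each the difference of an open half-space (a
    countable union of closed ones) and a closed one; an open set is a countable
    union of balls. *)

(** * Lebesgue measurability of open sets *)

Section measurability.
Context {R : realType} {n : nat}.
Local Notation E := 'rV[R]_n.+1.

Definition box_below (i : 'I_n.+1) (a : R) (q : E * E) : E * E :=
  (q.1, \row_j (if j == i then Num.min (q.2 ord0 j) a else q.2 ord0 j)).

Definition box_above (i : 'I_n.+1) (a : R) (q : E * E) : E * E :=
  (\row_j (if j == i then Num.max (q.1 ord0 j) a else q.1 ord0 j), q.2).

(** Only the factor [i] of the product differs between the three volumes. *)
Lemma box_volume_split i a (q : E * E) :
  box_volume (box_below i a q) + box_volume (box_above i a q) = box_volume q.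
Proof.
rewrite /box_volume !(bigD1 (P := xpredT) i)//=.
set p := (X in _ * X + _); set p' := (X in _ + _ * X); set p0 := (X in _ = _ * X).
have -> : p = p0 by apply: eq_bigr => j /negbTE ji; rewrite !mxE ji.
have -> : p' = p0 by apply: eq_bigr => j /negbTE ji; rewrite !mxE ji.
rewrite -mulrDl !mxE eqxx; congr (_ * _).
move: (q.1 ord0 i) (q.2 ord0 i) => l b.
by rewrite /Num.min /Num.max; repeat case: ifPn; rewrite -?leNgt; lra.
Qed.

(** Cutting every box of a cover of [X] along the hyperplane gives covers of the
    two parts of [X] with the same total volume. *)
Lemma measurable_halfspace (i : 'I_n.+1) (a : R) :
  measurable ([set x : E | x ord0 i <= a] : set (lebesgue_space R n)).
Proof.
apply: le_caratheodory_measurable => X /=.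
apply: le_ereal_inf_tmp => _ [q Xq <-].
have -> : (\sum_(0 <= k <oo) (box_volume (q k))%:E =
   \sum_(0 <= k <oo) (box_volume (box_below i a (q k)))%:E +
   \sum_(0 <= k <oo) (box_volume (box_above i a (q k)))%:E)%E.
  rewrite -nneseriesD; try by move=> k _ _; rewrite lee_fin box_volume_ge0.
  by apply: eq_eseriesr => k _; rewrite -EFinD box_volume_split.
apply: leeD; apply: ereal_inf_lbound.
- exists (box_below i a \o q) => //= x [/Xq[k _ qkx] /= xa]; exists k => //= j.
  by rewrite mxE; case: eqP => [->|_]; have := qkx i; have := qkx j => //;
    rewrite le_min xa andbT.
- exists (box_above i a \o q) => //= x [/Xq[k _ qkx] /= /negP xa]; exists k => //= j.
  rewrite -ltNge in xa.
  by rewrite mxE; case: eqP => [->|_]; have := qkx i; have := qkx j => //;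
    rewrite gt_max xa andbT.
Qed.

Lemma measurable_ball (x : E) (e : R) :
  measurable (ball x e : set (lebesgue_space R n)).
Proof.
have [e0|e0] := ltP 0 e; last first.
  suff -> : ball x e = set0 by exact: measurable0.
  by apply/seteqP; split => // y []; rewrite ltNge e0.
have mlt i a : measurable ([set y : E | y ord0 i < a] : set (lebesgue_space R n)).
  rewrite (_ : mkset _ = \bigcup_k [set y : E | y ord0 i <= a - k.+1%:R^-1]).
    by apply: bigcupT_measurable => k; exact: measurable_halfspace.
  apply/seteqP; split => [y /= ya|y [k _ /=] /le_lt_trans]; last first.
    by apply; rewrite ltrBlDr ltrDl.
  have ay : 0 < a - y ord0 i by rewrite subr_gt0.
  have [k _ /(_ k (leqnn k)) /= ka] := near_infty_natSinv_lt (PosNum ay).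
  by exists k => //=; rewrite lerBrDr -lerBrDl ltW.
rewrite (_ : ball x e = \bigcap_(i : 'I_n.+1)
    ([set y : E | y ord0 i < x ord0 i + e] `\` [set y : E | y ord0 i <= x ord0 i - e])).
  apply: fin_bigcap_measurable => // i _.
  by apply: measurableD => //; exact: measurable_halfspace.
apply/seteqP; split => [y [_ xy] i _ /=|y xy].
  by have := xy ord0 i; rewrite /ball /= ltr_norml => /andP[? ?];
    split; [|apply/negP]; lra.
split => // j i; rewrite !ord1; have [/= ? /negP] := xy i I.
by rewrite /ball /= ltr_norml -ltNge => ?; apply/andP; split; lra.
Qed.

(** Balls with rational centre and radius [1 / k.+1] form a countable base, so
    an open set is the union of those that it contains. *)
Lemma measurable_open (U : set E) :
  open U -> measurable (U : set (lebesgue_space R n)).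
Proof.
move=> oU.
pose c (q : 'rV[rat]_n.+1) : E := map_mx ratr q.
pose F (p : 'rV[rat]_n.+1 * nat) : set (lebesgue_space R n) :=
  if `[< ball (c p.1) p.2.+1%:R^-1 `<=` U >] then ball (c p.1) p.2.+1%:R^-1
  else set0.
rewrite (_ : U = \bigcup_p F p).
  apply: countable_bigcupT_measurable => // p.
  by rewrite /F; case: asboolP => _; [exact: measurable_ball|exact: measurable0].
apply/seteqP; split => [x Ux|x [p _]]; last by rewrite /F; case: asboolP => // + ?; exact.
have /nbhs_ballP[_/posnumP[e] xeU] := open_nbhs_nbhs (conj oU Ux).
(* The radius is below [e / 2], so a ball that contains [x] stays within [e] of
   [x] although it is centred elsewhere. *)
have [k _ /(_ k (leqnn k)) /= ke] := near_infty_natSinv_lt (e%:num / 2)%:pos.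
have k0 : 0 < k.+1%:R^-1 :> R by rewrite invr_gt0.
have q_ i : {q : rat | ball (x ord0 i) k.+1%:R^-1 (ratr q)}.
  have lt : x ord0 i < x ord0 i + k.+1%:R^-1 by rewrite ltrDl.
  have /cid[q qP] := rat_in_itvoo lt; exists q.
  move: qP; rewrite in_itv/= /ball/= => /andP[xq qx].
  by rewrite distrC ltr_norml ltrBlDl qx andbT
    (lt_trans _ (_ : 0 < _)) ?subr_gt0// oppr_lt0.
pose q := \row_i (sval (q_ i)).
have xq : ball x k.+1%:R^-1 (c q).
  by split => // j i; rewrite !ord1 !mxE; exact: svalP (q_ i).
exists (q, k) => //; rewrite /F asboolT /=; first exact: ball_sym.
move=> y /(ball_triangle xq) xy; apply: xeU; apply: le_ball xy.
by rewrite [leRHS]splitr lerD// ltW.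
Qed.

Lemma continuous_measurable_fun (U : set E) (f : E -> R) :
  open U -> (forall x, U x -> {for x, continuous f}) ->
  measurable_fun (U : set (lebesgue_space R n)) f.
Proof.
move=> oU cf; apply: (measurability _ (RGenOInfty.measurableE R)).
move=> _ [_ [a ->] <-]; apply: measurable_open.
rewrite openE => x [Ux /= fxa]; apply: filterI.
  exact: open_nbhs_nbhs.
by apply: cf => //; apply: open_nbhs_nbhs.
Qed.

End measurability.

(** * Derivatives at a maximum *)

Section one_variable.
Context {R : realType}.

(** The difference quotients from the left are nonnegative, and they converge to
    the two-sided derivative. *)
Lemma derive1_ge0_left_max (f : R -> R) (a b : R) : a < b ->
  derivable f b 1 -> (forall t, a < t -> t < b -> f t <= f b) ->
  0 <= derive1 f b.
Proof.
move=> ab df fle; rewrite derive1E.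
rewrite ['D_1 f b]cvg_at_leftE; last exact: df.
apply: limr_ge.
  rewrite -(cvg_at_leftE (fun h : R => h^-1 *: ((f \o shift b) _ - f b))) //.
  apply: cvg_trans (df); apply: cvg_app.
  move=> A [e egt0 Ae]; exists e => // x xe xgt0; apply: Ae => //.
  exact/ltr0_neq0.
near=> h; apply: mulr_le0.
  by rewrite invr_le0; apply: ltW; near: h; exists 1 => /=.
have h0 : h < 0 by near: h; exists 1 => /=.
have ha : a - b < h.
  near: h; apply: nbhs_left_gt; by rewrite subr_lt0.
by rewrite subr_le0 [_%:A]mulr1 /=; apply: fle; lra.
Unshelve. all: by end_near. Qed.

(** The first derivative vanishes at the maximum. If the second derivative were
    positive there, the first one would be positive just to the right, and [f]
    would increase above its maximum. *)
Lemma derive1_derive1_le0_max (f : R -> R) (d : R) : 0 < d ->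
  (forall t, t \in `]-d, d[ -> derivable f t 1) ->
  derivable (derive1 f) 0 1 ->
  (forall t, t \in `]-d, d[ -> f t <= f 0) ->
  derive1 (derive1 f) 0 <= 0.
Proof.
move=> d0 df ddf fle.
have f'0 : derive1 f 0 = 0.
  rewrite derive1E; apply: derive_val; apply: derive1_at_max df _ fle; first lra.
  by rewrite in_itv /=; lra.
rewrite leNgt; apply/negP => f''gt0.
rewrite derive1E in f''gt0.
have := cvgr_gt _ ddf _ f''gt0.
move=> [e /= e0 He].
have f'gt0 t : 0 < t -> t < e -> 0 < derive1 f t.
  move=> t0 te; have := He t; rewrite /= distrC subr0 gtr0_norm// => /(_ te).
  rewrite f'0 subr0 [_%:A]mulr1 addr0 => /(_ (lt0r_neq0 t0)).
  by rewrite /GRing.scale/= pmulr_rgt0// invr_gt0.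
pose h := Num.min d e / 2.
have [h0 hd he] : [/\ 0 < h, h < d & h < e].
  by rewrite /h /Num.min; case: ifPn; rewrite -?leNgt => ?; split; lra.
have dfh t : t \in `[0, h] -> derivable f t 1.
  by rewrite in_itv/= => ?; apply: df; rewrite in_itv/=; lra.
have : f 0 < f h.
  apply: (@gtr0_derive1_lt_cc _ f 0 h) => //; rewrite ?in_itv/= ?lexx ?(ltW h0)//.
  - by move=> t; rewrite in_itv/= => ?; apply: dfh; rewrite in_itv/=; lra.
  - by move=> t; rewrite in_itv/= => ?; apply: f'gt0; lra.
  - exact: derivable_within_continuous.
by apply/negP; rewrite -leNgt; apply: fle; rewrite in_itv/=; lra.
Qed.
End one_variable.

Section several_variables.
Context {R : realType} {n : nat}.
Local Notation E := 'rV[R]_n.+1.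
Implicit Types (f g : E -> R) (U : set E).

Definition on_line f (v x : E) : R -> R := fun h => f (h *: v + x).

Lemma derivable_line f v x h :
  derivable (on_line f v x) h 1 <-> derivable f (h *: v + x) v.
Proof.
rewrite /derivable /on_line /=.
suff -> : (fun k : R => k^-1 *: (f ((k *: 1 + h) *: v + x) - f (h *: v + x))) =
  (fun k : R => k^-1 *: (f (k *: v + (h *: v + x)) - f (h *: v + x))) by [].
by apply/funext => k; rewrite addrA -scalerDl [_%:A]mulr1.
Qed.

Lemma derive1_line f v x :
  derive1 (on_line f v x) = on_line (fun y => 'D_v f y) v x.
Proof.
apply/funext => h; rewrite derive1E /derive /on_line /=.
suff -> : (fun k : R => k^-1 *: (f ((k *: 1 + h) *: v + x) - f (h *: v + x))) =
  (fun k : R => k^-1 *: (f (k *: v + (h *: v + x)) - f (h *: v + x))) by [].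
by apply/funext => k; rewrite addrA -scalerDl [_%:A]mulr1.
Qed.

(** The one-variable second derivative test on the line through [x] directed by
    [v]. *)
Lemma derive2_le0_max U f x v : open U -> U x ->
  (forall y, U y -> derivable f y v) ->
  derivable (fun y => 'D_v f y) x v ->
  (forall y, U y -> f y <= f x) ->
  'D_v (fun y => 'D_v f y) x <= 0.
Proof.
move=> oU Ux df ddf fle.
have line0 g : on_line g v x 0 = g x by rewrite /on_line scale0r add0r.
have : \forall h \near (0 : R), U (h *: v + x).
  have : (h *: v + x) @[h --> (0 : R)] --> x.
    rewrite -{2}[x]add0r -[X in _ --> X + _](scale0r v).
    by apply: cvgD; [apply: cvgZr_tmp; exact: cvg_id|exact: cvg_cst].
  by apply; exact: open_nbhs_nbhs.
move=> /nbhs_ballP[d /= d0 dU].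
have Ud t : t \in `]-d, d[ -> U (t *: v + x).
  move=> td; apply: dU; rewrite /ball/= sub0r normrN ltr_norml.
  by rewrite in_itv/= in td.
rewrite -(line0 (fun y => 'D_v (fun z => 'D_v f z) y)) -!derive1_line.
apply: (derive1_derive1_le0_max d0) => [t td||t td].
- by apply/derivable_line/df/Ud.
- by rewrite derive1_line; apply/derivable_line; rewrite scale0r add0r.
- by rewrite line0; apply/fle/Ud.
Qed.

Lemma laplacian_le0_max U f x : open U -> Ck_on 2 U f -> U x ->
  (forall y, U y -> f y <= f x) -> laplacian f x <= 0.
Proof.
move=> oU [_ C2f] Ux fle; apply: sumr_le0 => i _.
have [df [_ C1]] := C2f i; have [ddf _] := C1 i.
exact: (derive2_le0_max oU Ux df (ddf x Ux) fle).
Qed.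

Lemma near_eq_on U f g x : open U -> (forall y, U y -> f y = g y) -> U x ->
  {near x, f =1 g}.
Proof.
move=> oU fg Ux; rewrite /prop_near1; apply: filterS (open_nbhs_nbhs (conj oU Ux)).
exact: fg.
Qed.

Lemma continuous_eq_on U f g x : open U -> (forall y, U y -> f y = g y) -> U x ->
  {for x, continuous f} -> {for x, continuous g}.
Proof.
move=> oU fg Ux; rewrite /prop_for /continuous_at fg//.
apply: cvg_trans; apply: (@near_eq_cvg _ _ (nbhs x)).
exact: (near_eq_on oU fg Ux).
Qed.

Lemma partial_eq_on U f g i : open U -> (forall x, U x -> f x = g x) ->
  forall x, U x -> partial i f x = partial i g x.
Proof. by move=> oU fg x Ux; apply: near_eq_derive; exact: (near_eq_on oU fg Ux). Qed.

(** [Ck_on] speaks of global functions through their germs in [U]; this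
    extensionality is what lets the partial derivatives of a difference be
    computed on [U], the only place where they are known. *)
Lemma Ck_on_eq k U f g : open U -> (forall x, U x -> f x = g x) ->
  Ck_on k U f -> Ck_on k U g.
Proof.
move=> oU; elim: k f g => [|k IH] f g fg [cf Cf];
  split => //; try by move=> x Ux; exact: (continuous_eq_on oU fg Ux (cf x Ux)).
move=> i; have [df Cp] := Cf i; split=> [x Ux|].
  exact: near_eq_derivable (near_eq_on oU fg Ux) (df x Ux).
by apply: IH Cp; exact: partial_eq_on.
Qed.

Lemma partialB_on U f g i : (forall x, U x -> derivable f x (delta_mx ord0 i)) ->
  (forall x, U x -> derivable g x (delta_mx ord0 i)) ->
  forall x, U x -> partial i (f - g) x = (partial i f - partial i g) x.
Proof. by move=> df dg x Ux; rewrite /partial deriveB; auto. Qed.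

Lemma Ck_onB k U f g : open U -> Ck_on k U f -> Ck_on k U g -> Ck_on k U (f - g).
Proof.
move=> oU; elim: k f g => [|k IH] f g [cf Cf] [cg Cg]; split => //.
1,2: by move=> x Ux; apply: continuousB; [exact: cf|exact: cg].
move=> i; have [df Cpf] := Cf i; have [dg Cpg] := Cg i; split=> [x Ux|].
  by apply: derivableB; [exact: df|exact: dg].
apply: Ck_on_eq (IH _ _ Cpf Cpg) => // x Ux.
by rewrite (partialB_on df dg).
Qed.

Lemma laplacianB U f g x : open U -> Ck_on 2 U f -> Ck_on 2 U g -> U x ->
  laplacian (f - g) x = laplacian f x - laplacian g x.
Proof.
move=> oU [_ Cf] [_ Cg] Ux; rewrite /laplacian -sumrB; apply: eq_bigr => i _.
have [df [_ C1f]] := Cf i; have [dg [_ C1g]] := Cg i.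
rewrite (partial_eq_on _ oU (partialB_on df dg) Ux).
exact: (partialB_on (C1f i).1 (C1g i).1).
Qed.

End several_variables.

(** * The nonlocal term and the exponential weight *)

(** The derivative of [exp (- l t) * f t] at [b] is
    [exp (- l b) * (f' b - l * f b)], and it is nonnegative. *)
Lemma derive1_ge_exp_left_max {R : realType} (f : R -> R) (l a b : R) : a < b ->
  derivable f b 1 ->
  (forall t, a < t -> t < b -> expR (- l * t) * f t <= expR (- l * b) * f b) ->
  l * f b <= derive1 f b.
Proof.
move=> ab df fle.
have df' : is_derive b 1 f (derive1 f b) by rewrite derive1E; exact: DeriveDef.
pose g t := expR (- l * t) * f t.
have dexp : is_derive b 1 (fun t : R => expR (- l * t)) (expR (- l * b) * - l).
  apply: (@is_derive1_comp _ expR (fun t => - l * t)).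
  rewrite -[X in is_derive _ _ _ X]mulr1.
  exact: (@is_deriveZ _ _ _ id).
have dg : is_derive b 1 g (expR (- l * b) * (derive1 f b - l * f b)).
  apply: (is_derive_eq (is_deriveM dexp df')).
  rewrite /GRing.scale/=; ring.
have dgb : derivable g b 1 by [].
have := derive1_ge0_left_max ab dgb fle.
by rewrite derive1E derive_val pmulr_rge0 ?expR_gt0// subr_ge0.
Qed.

(** Pointwise, [max (f - a) 0 <= max (g - a) 0 + m]: the positive part is
    nondecreasing and 1-Lipschitz. The integrals may be infinite. *)
Lemma ge0_integral_pos_part_le d (T : measurableType d) (R : realType)
    (mu : {measure set T -> \bar R}) (D : set T) (f g k : T -> R) (a m : R) :
  measurable D -> measurable_fun D f -> measurable_fun D g ->
  measurable_fun D k -> (forall y, D y -> 0 <= k y) -> 0 <= m ->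
  (forall y, D y -> f y <= g y + m) ->
  (\int[mu]_(y in D) (Num.max (f y - a) 0 * k y)%:E <=
   \int[mu]_(y in D) (Num.max (g y - a) 0 * k y)%:E +
   m%:E * \int[mu]_(y in D) (k y)%:E)%E.
Proof.
move=> mD mf mg mk k0 m0 fg.
have mpos (h : T -> R) : measurable_fun D h ->
    measurable_fun D (fun y => (Num.max (h y - a) 0 * k y)%:E).
  move=> mh; apply/measurable_EFinP.
  apply: measurable_funM => //.
  apply: measurable_maxr => //.
  exact: measurable_funB.
have pos0 (h : T -> R) y : D y -> (0 <= (Num.max (h y - a) 0 * k y)%:E)%E.
  by move=> Dy; rewrite lee_fin mulr_ge0 ?k0// le_max lexx orbT.
have mkE : measurable_fun D (EFin \o k) by exact/measurable_EFinP.
rewrite -ge0_integralZl_EFin//.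
rewrite -ge0_integralD//; last 4 first.
- exact: pos0.
- exact: mpos.
- by move=> y Dy; rewrite -EFinM lee_fin mulr_ge0// k0.
- exact: measurable_funeM.
apply: ge0_le_integral => //; try exact: pos0; try exact: mpos.
- by apply: emeasurable_funD; [exact: mpos|exact: measurable_funeM].
- move=> y Dy; rewrite -EFinM -EFinD lee_fin -mulrDl ler_wpM2r ?k0//.
  have := fg y Dy; rewrite ge_max; case: (leP (g y - a) 0); rewrite /Num.max; lra.
Qed.

Section space_time.
Context {R : realType} {n : nat}.
Local Notation E := 'rV[R]_n.+1.
Implicit Types (Omega : set E) (w : E -> R -> R).

Lemma compact_closure_bounded Omega : bounded_set Omega -> compact (closure Omega).
Proof.
move=> bO; apply: bounded_closed_compact; last exact: closed_closure.
have [M [_ MO]] := bO; exists M; split; first exact: num_real.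
move=> N MN x Ox /=.
have cl := @closed_closed_ball_ _ E 0 N.
have sub : Omega `<=` closed_ball_ (fun x => `|x|) (0 : E) N.
  by move=> y /(MO N MN) /=; rewrite /closed_ball_ /= sub0r normrN.
have := closureS sub Ox; rewrite -((closure_id _).1 cl).
by rewrite /closed_ball_ /= sub0r normrN.
Qed.

Lemma weighted_max Omega w (l T : R) : bounded_set Omega -> Omega !=set0 ->
  0 <= T ->
  {within closure Omega `*` [set t | 0 <= t], continuous (uncurry w)} ->
  exists x t, [/\ closure Omega x, 0 <= t, t <= T &
   forall y s, closure Omega y -> 0 <= s -> s <= T ->
     expR (- l * s) * w y s <= expR (- l * t) * w x t].
Proof.
move=> bO [z Oz] T0 cw.
pose A := closure Omega `*` [set` `[0, T]].
have cA : compact A.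
  apply: compact_setX; last exact: segment_compact.
  exact: compact_closure_bounded.
have [||[x t] /set_mem[/= clx]] :=
  compact_EVT_max (f := fun p => expR (- l * p.2) * uncurry w p) _ cA.
- exists (z, 0); split; first exact: subset_closure.
  by rewrite /= in_itv/= lexx.
- have sub : A `<=` closure Omega `*` [set t | 0 <= t].
    by move=> [y s] [? /=]; rewrite in_itv/= => /andP[].
  have := continuous_subspaceW sub cw.
  move=> H p; apply: cvgM; last exact: H.
  have : continuous (fun p : E * R => expR (- l * p.2)).
    move=> q; apply: continuous_comp; last exact: continuous_expR.
    apply: cvgM; [exact: cvg_cst|exact: cvg_snd].
  by move/continuous_subspaceT => /(_ A p).
rewrite in_itv/= => /andP[t0 tT] Hmax.
exists x, t; split=> // y s Oy s0 sT.
by apply: (Hmax (y, s)); apply/mem_set; split => //=; rewrite in_itv/= s0.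
Qed.
End space_time.

(** * The comparison principle *)

Theorem lemma2p1 (R : realType) (n : nat) (Omega : set 'rV[R]_n.+1)
  (c Theta : R) (K : 'rV[R]_n.+1 -> 'rV[R]_n.+1 -> R)
  (u v : 'rV[R]_n.+1 -> R -> R)
  (hOmega : bounded_smooth_domain Omega)
  (hc : 0 < c)
  (hK : admissible_kernel Omega K)
  (hu : regular Omega u)
  (hv : regular Omega v)
  (hsub : forall (x : 'rV[R]_n.+1) (t : R), Omega x -> 0 < t ->
    ((derive1 (u x) t)%:E
      <= (c * laplacian (u ^~ t) x)%:E + source Omega K Theta u x t)%E)
  (hsuper : forall (x : 'rV[R]_n.+1) (t : R), Omega x -> 0 < t ->
    ((c * laplacian (v ^~ t) x)%:E + source Omega K Theta v x t
      <= (derive1 (v x) t)%:E)%E)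
  (hinit : forall x : 'rV[R]_n.+1, Omega x -> u x 0 <= v x 0)
  (hbdry : forall (x : 'rV[R]_n.+1) (t : R), bdry Omega x -> 0 <= t -> u x t <= v x t) :
  forall (x : 'rV[R]_n.+1) (t : R), Omega x -> 0 <= t -> u x t <= v x t.
Proof.
move=> x1 t1 Ox1 t10; rewrite leNgt; apply/negP => uv1.
have [oO _ _ bO _] := hOmega.
have [K0 _ _ mK supK] := hK.
have [[cu du C2u] [cv dv C2v]] := (hu, hv).
set Ks := (X in (ereal_sup X < _)%E) in supK.
have intK_ge0 x : Omega x -> (0 <= \int[lebesgue_rV R n]_(y in Omega) (K x y)%:E)%E.
  by move=> Ox; apply: integral_ge0 => y Oy; rewrite lee_fin K0.
have intK_le x : Omega x ->
    (\int[lebesgue_rV R n]_(y in Omega) (K x y)%:E <= ereal_sup Ks)%E.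
  by move=> Ox; apply: ereal_sup_ubound; exists x.
have [S supKE] : exists S : R, ereal_sup Ks = S%:E.
  exists (fine (ereal_sup Ks)); rewrite fineK// ge0_fin_numE//.
  exact: le_trans (intK_ge0 _ Ox1) (intK_le _ Ox1).
rewrite supKE in intK_le.
pose w x t := u x t - v x t.
have cw : {within closure Omega `*` [set t | 0 <= t], continuous (uncurry w)}.
  rewrite (_ : uncurry w = uncurry u - uncurry v); last by apply/funext => -[].
  exact: within_continuousB.
(* The rate [S + 1] exceeds what the nonlocal term can feed into [u - v]. *)
have [x0 [t0 [clx0 t0_ge0 t0t1 wmax]]] :=
  weighted_max (S + 1) bO (ex_intro _ _ Ox1) t10 cw.
have w0 : 0 < w x0 t0.
  have := wmax x1 t1 (subset_closure Ox1) t10 (lexx _).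
  rewrite -(pmulr_rgt0 _ (expR_gt0 (- (S + 1) * t0))); apply: lt_le_trans.
  by rewrite mulr_gt0 ?expR_gt0// subr_gt0.
have uv0 : v x0 t0 < u x0 t0 by rewrite -subr_gt0.
have Ox0 : Omega x0.
  have [/interior_subset//|nint] := pselect (Omega° x0).
  by have := hbdry x0 t0 (conj clx0 nint) t0_ge0; rewrite leNgt uv0.
have t0_gt0 : 0 < t0.
  rewrite lt_neqAle t0_ge0 andbT; apply/negP => /eqP t00.
  by have := hinit x0 Ox0; rewrite leNgt t00 uv0.
have wle y : Omega y -> u y t0 - v y t0 <= w x0 t0.
  move=> Oy; rewrite -(ler_pM2l (expR_gt0 (- (S + 1) * t0))).
  exact: wmax (subset_closure Oy) t0_ge0 t0t1.
have lap_le : laplacian (u ^~ t0) x0 <= laplacian (v ^~ t0) x0.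
  rewrite -subr_le0 -(laplacianB oO (C2u _ t0_gt0) (C2v _ t0_gt0) Ox0).
  by apply: (laplacian_le0_max oO) => //; apply: Ck_onB => //; [exact: C2u|exact: C2v].
have [[dut _] [dvt _]] := (du _ Ox0 _ t0_gt0, dv _ Ox0 _ t0_gt0).
have der_ge : (S + 1) * w x0 t0 <= derive1 (u x0) t0 - derive1 (v x0) t0.
  rewrite !derive1E -deriveB// -derive1E.
  apply: (derive1_ge_exp_left_max t0_gt0); first exact: derivableB.
  move=> t t_gt0 tt0.
  by apply: wmax => //; [exact: ltW|exact: le_trans (ltW tt0) t0t1].
have mO : measurable (Omega : set (lebesgue_space R n)) by exact: measurable_open.
have src_le : (source Omega K Theta u x0 t0 <=
    source Omega K Theta v x0 t0 + (w x0 t0 * S)%:E)%E.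
  have mu_t0 := continuous_measurable_fun oO (C2u _ t0_gt0).1.
  have mv_t0 := continuous_measurable_fun oO (C2v _ t0_gt0).1.
  have uvw y : Omega y -> u y t0 <= v y t0 + w x0 t0.
    by move=> Oy; rewrite -lerBlDl; exact: wle.
  apply: le_trans (ge0_integral_pos_part_le (lebesgue_rV R n) Theta mO mu_t0 mv_t0
    (mK _ Ox0) (fun y => K0 x0 y Ox0) (ltW w0) uvw) _.
  by rewrite leeD2l// EFinM lee_pmul2l// intK_le.
have srcv_ge0 : (0 <= source Omega K Theta v x0 t0)%E.
  apply: integral_ge0 => y Oy.
  by rewrite lee_fin mulr_ge0 ?K0// le_max lexx orbT.
(* [hsuper] bounds the source of [v] by a real number and [src_le] then bounds
   that of [u], so the inequalities can be combined in [R]. *)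
have := hsub _ _ Ox0 t0_gt0; have := hsuper _ _ Ox0 t0_gt0.
case: (source Omega K Theta v x0 t0) src_le srcv_ge0 => [s| |]//.
case: (source Omega K Theta u x0 t0) => [r| |]//.
rewrite -!EFinD !lee_fin => rs s0 vs ur.
have := ler_wpM2l (ltW hc) lap_le.
lra.
Qed.
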